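(* For every positive integer $n$, $$\mathrm{ex}(n,\mathbf A\mathbf B\mathbf C)=\left\lfloor\tfrac14(n-1)^2\right\rfloor,$$ and a triple system $\mathcal F$ on $n$ vertices containing none of $\mathbf A,\mathbf B,\mathbf C$ attains equality, $|\mathcal F|=\lfloor\frac14(n-1)^2\rfloor$, if and only if it is isomorphic to $\mathcal F^*_n$.
   Context: A triple system on a finite vertex set $V$, $|V|=n$, is a family $\mathcal F$ of distinct $3$-element subsets (triples) of $V$. We write $124$ for $\{1,2,4\}$ etc. $\mathbf A=\{124,135,236\}$ (on 6 vertices), $\mathbf B=\{125,134,234\}$ (on 5 vertices), $\mathbf C=\{124,134,234\}$ (on 4 vertices). A triple system contains a configuration if some of its triples form a system isomorphic to it (not necessarily induced). $\mathrm{ex}(n,X_1\dots X_k)$ denotes the maximum number of triples in a triple system on $n$ vertices that contains none of $X_1,\dots,X_k$. $\mathcal F^*_n$ is the following triple system on an $n$-element set $V$: fix a vertex $x\in V$ and a complete bipartite graph on $V\setminus\{x\}$ with parts of sizes $\lfloor\frac{n-1}{2}\rfloor$ and $\lceil\frac{n-1}{2}\rceil$; the triples of $\mathcal F^*_n$ are exactly the sets consisting of $x$ and the two ends of an edge of this bipartite graph. *)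

(* Defs.v *)
From mathcomp Require Import all_boot.

Set Implicit Arguments.
Unset Strict Implicit.
Unset Printing Implicit Defensive.

Definition triple_system (V : finType) (F : {set {set V}}) : bool :=
  [forall e in F, #|e| == 3].

Definition isomorphic (V W : finType) (F : {set {set V}}) (G : {set {set W}}) :
    Prop :=
  exists f : V -> W, bijective f /\ [set f @: (e : {set V}) | e in F] = G.

(* A configuration on the vertices 1, ..., m is encoded on 'I_m, the label k
   being the ordinal of value k - 1.  Configurations of different orders are
   packed together so that they can be listed. *)
Definition config : Type := {m : nat & {set {set 'I_m}}}.

Definition Config (m : nat) (X : {set {set 'I_m}}) : config :=
  existT (fun k : nat => {set {set 'I_k}}) m X.

Definition triple (m a b c : nat) : {set 'I_m} :=
  [set i : 'I_m | i.+1 \in [:: a; b; c]].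

Definition confA : config :=
  Config [set triple 6 1 2 4; triple 6 1 3 5; triple 6 2 3 6].
Definition confB : config :=
  Config [set triple 5 1 2 5; triple 5 1 3 4; triple 5 2 3 4].
Definition confC : config :=
  Config [set triple 4 1 2 4; triple 4 1 3 4; triple 4 2 3 4].

(* Not necessarily induced: the copy of X only has to be a subfamily of F. *)
Definition contains (V : finType) (F : {set {set V}}) (X : config) : bool :=
  [exists f : {ffun 'I_(projT1 X) -> V},
    injectiveb f
    && ([set f @: (e : {set 'I_(projT1 X)}) | e in projT2 X] \subset F)].

Definition avoids (V : finType) (F : {set {set V}}) (Xs : seq config) : bool :=
  all (fun X => ~~ contains F X) Xs.

Definition ex (n : nat) (Xs : seq config) : nat :=
  \max_(F : {set {set 'I_n}} | triple_system F && avoids F Xs) #|F|.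

(* For n > 0 this type has n elements: None is the special vertex x, and the
   two summands are the sides of the bipartite graph, of sizes
   floor((n-1)/2) and ceil((n-1)/2). *)
Definition Fstar_vertex (n : nat) : finType :=
  option ('I_(n.-1./2) + 'I_(uphalf n.-1))%type.

Definition Fstar (n : nat) : {set {set Fstar_vertex n}} :=
  [set [set None; Some (inl i); Some (inr j)]
    | i in 'I_(n.-1./2), j in 'I_(uphalf n.-1)].

(* Main.v *)
Require Import Defs.
From mathcomp Require Import all_boot zify.

Set Implicit Arguments.
Unset Strict Implicit.
Unset Printing Implicit Defensive.

(** Three triples covering the three pairs xy, xz, yz, none of them equal to
    xyz, form a copy of A, B or C according to how many of their third vertices
    coincide.  So the condition on the triple system F is that it has no such
    cyclic pattern ([berge_free]).

    Applied to the three pairs of a single triple T of F, this says that some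
    pair of T lies in no other triple of F.  Choose one such pair, the base of
    T, and call the remaining vertex of T its apex ([exists_apex_choice]).  The
    bases are the edges of a graph H on V with exactly |F| edges.

    Two facts drive the proof.  For a triple T, the H-neighbourhoods of its
    three vertices are pairwise disjoint ([base_nbhd_disjoint]) and none of them
    contains the apex, so the H-degrees of the vertices of T add up to at most
    n - 1 ([sum_degree_triple]).  In particular H is triangle-free.

    Suppose that H has no isolated vertex, and let m = |F| and d be the
    H-degree.  Summing the degree inequality over all triples counts every
    vertex v once for each base at v, which gives the sum of the squares of d,
    and once for each apex at v, which gives at least m in total.  Hence
    sum d^2 <= m (n - 2), and sum d = 2m with the Cauchy-Schwarz inequality
    yields 4m <= n (n - 2) < (n - 1)^2.  For even n this still allows m to be
    the floor of (n - 1)^2 / 4, but then H is regular of degree (n - 2) / 2, and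
    the degree inequality forces n = 4 ([few_triples_of_no_isolated]).  In that
    case F consists of two triples with a common vertex x, and taking x as the
    apex of both produces a choice of bases for which x is isolated.

    Suppose that H has an isolated vertex x.  Then H is a triangle-free graph on
    n - 1 vertices, and Mantel's theorem gives the bound.  In the case of
    equality H is a balanced complete bipartite graph on the complement of x.
    An apex is H-adjacent to neither end of its base, whereas every vertex other
    than x is adjacent to one end of every edge; so x is the apex of every
    triple, and F is the extremal system ([triples_with_isolated]). *)

(** * Forbidden configurations as Berge triangles *)

Definition berge_free (V : finType) (F : {set {set V}}) : Prop :=
  forall x y z Txy Txz Tyz,
    Txy \in F -> Txz \in F -> Tyz \in F ->
    [/\ x \in Txy, y \in Txy & z \notin Txy] ->
    [/\ x \in Txz, z \in Txz & y \notin Txz] ->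
    [/\ y \in Tyz, z \in Tyz & x \notin Tyz] -> False.

Lemma imset_triple (V : finType) (m a b c : nat) (f : 'I_m -> V)
    (ha : a < m) (hb : b < m) (hc : c < m) :
  f @: triple m a.+1 b.+1 c.+1 =
    [set f (Ordinal ha); f (Ordinal hb); f (Ordinal hc)].
Proof.
have -> : triple m a.+1 b.+1 c.+1 =
    [set Ordinal ha; Ordinal hb; Ordinal hc].
  by apply/setP=> i; rewrite !inE -!val_eqE /= !eqSS orbA.
by rewrite !imsetU !imset_set1.
Qed.

Lemma contains_three (V : finType) (F : {set {set V}}) (m : nat)
    (e1 e2 e3 : {set 'I_m}) (x0 : V) (s : seq V) :
  let f (i : 'I_m) := nth x0 s i in
  uniq s -> size s = m -> f @: e1 \in F -> f @: e2 \in F -> f @: e3 \in F ->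
  contains F (Config [set e1; e2; e3]).
Proof.
move=> f us ss h1 h2 h3; apply/existsP; exists (finfun f).
have fE (e : {set 'I_m}) : finfun f @: e = f @: e.
  by apply: eq_imset => i; rewrite ffunE.
apply/andP; split.
  apply/injectiveP=> i j; rewrite !ffunE /f => /eqP.
  by rewrite nth_uniq ?ss // => /eqP/val_inj.
apply/subsetP=> _ /imsetP[e + ->]; rewrite /= fE !inE.
by case/orP=> [/orP[]|] /eqP->.
Qed.

Lemma containsP3 (V : finType) (F : {set {set V}}) (m : nat)
    (e1 e2 e3 : {set 'I_m}) :
  contains F (Config [set e1; e2; e3]) ->
  exists f : 'I_m -> V,
    injective f /\ [/\ f @: e1 \in F, f @: e2 \in F & f @: e3 \in F].
Proof.
case/existsP=> f /andP[/injectiveP injf /subsetP sub]; exists f; split=> //.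
by split; apply: sub; apply/imsetP; eexists; try reflexivity;
  rewrite !inE eqxx ?orbT.
Qed.

Lemma triple_third (V : finType) (T : {set V}) (x y : V) :
  #|T| = 3 -> x \in T -> y \in T -> x != y ->
  exists2 a, T = [set x; y; a] & (a != x) && (a != y).
Proof.
move=> T3 xT yT xy.
have : #|(T :\ x) :\ y| == 1.
  by have := cardsD1 x T; have := cardsD1 y (T :\ x);
    rewrite !inE xT yT eq_sym xy T3; lia.
case/cards1P=> a Ea; exists a.
  have : a \in T :\ x :\ y by rewrite Ea inE.
  rewrite !inE => /and3P[_ _ aT].
  apply/setP=> t; move/setP/(_ t): Ea; rewrite !inE => <-.
  have [->|_] := eqVneq t x; first by rewrite xT.
  by have [->|_] := eqVneq t y; rewrite ?yT.
have : a \in T :\ x :\ y by rewrite Ea inE.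
by rewrite !inE => /and3P[-> -> _].
Qed.

(** The third vertices a, b, c of the triples covering xy, xz, yz are all equal
    in a copy of C, exactly two of them are equal in a copy of B, and they are
    distinct in a copy of A.  In B the labels 1 and 2 belong to the pair whose
    third vertex differs from the two others, hence the permuted lists of
    vertices in the mixed cases. *)
Lemma berge_free_of_avoids (V : finType) (F : {set {set V}}) :
  triple_system F -> avoids F [:: confA; confB; confC] -> berge_free F.
Proof.
move=> /forall_inP F3 /and4P[nA nB nC _] x y z T1 T2 T3 F1 F2 F3'.
move=> [x1 y1 z1] [x2 z2 y2] [y3 z3 x3].
have card3 T : T \in F -> #|T| = 3 by move=> /F3/eqP.
have xy : x != y by apply: contraNneq x3 => ->.
have xz : x != z by apply: contraNneq x3 => ->.
have yz : y != z by apply: contraNneq y2 => ->.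
have [a E1 /andP[ax ay]] := triple_third (card3 _ F1) x1 y1 xy.
have [b E2 /andP[bx bz]] := triple_third (card3 _ F2) x2 z2 xz.
have [c E3 /andP[cy cz]] := triple_third (card3 _ F3') y3 z3 yz.
have az : a != z by apply: contraNneq z1 => <-; rewrite E1 !inE eqxx orbT.
have bY : b != y by apply: contraNneq y2 => <-; rewrite E2 !inE eqxx orbT.
have cx : c != x by apply: contraNneq x3 => <-; rewrite E3 !inE eqxx orbT.
have perm21 (p q r : V) : [set p; q; r] = [set q; p; r] by rewrite (setUC [set p]).
have [ab|ab] := eqVneq a b; have [bc|bc] := eqVneq b c.
- subst b c; case/negP: nC; apply: (@contains_three _ _ 4 _ _ _ x [:: x; y; z; a]).
  + by rewrite /= !inE !negb_or xy xz yz !(eq_sym _ a) ax ay az.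
  + by [].
  + by rewrite (@imset_triple _ 4 0 1 3) //= -E1.
  + by rewrite (@imset_triple _ 4 0 2 3) //= -E2.
  + by rewrite (@imset_triple _ 4 1 2 3) //= -E3.
- subst b; case/negP: nB; apply: (@contains_three _ _ 5 _ _ _ x [:: y; z; x; a; c]).
  + by rewrite /= !inE !negb_or yz !(eq_sym _ x) !(eq_sym _ a) xy xz ax ay az
      !(eq_sym _ c) cx cy cz eq_sym bc.
  + by [].
  + by rewrite (@imset_triple _ 5 0 1 4) //= -E3.
  + by rewrite (@imset_triple _ 5 0 2 3) //= perm21 -E1.
  + by rewrite (@imset_triple _ 5 1 2 3) //= perm21 -E2.
- subst c; case/negP: nB; apply: (@contains_three _ _ 5 _ _ _ x [:: x; y; z; b; a]).
  + by rewrite /= !inE !negb_or xy xz yz !(eq_sym _ b) bx bY bz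
      !(eq_sym _ a) ax ay az ab.
  + by [].
  + by rewrite (@imset_triple _ 5 0 1 4) //= -E1.
  + by rewrite (@imset_triple _ 5 0 2 3) //= -E2.
  + by rewrite (@imset_triple _ 5 1 2 3) //= -E3.
have [ac|ac] := eqVneq a c.
- subst c; case/negP: nB; apply: (@contains_three _ _ 5 _ _ _ x [:: x; z; y; a; b]).
  + by rewrite /= !inE !negb_or xz xy (eq_sym z y) yz !(eq_sym _ a) ax ay az
      !(eq_sym _ b) bx bY bz eq_sym ab.
  + by [].
  + by rewrite (@imset_triple _ 5 0 1 4) //= -E2.
  + by rewrite (@imset_triple _ 5 0 2 3) //= -E1.
  + by rewrite (@imset_triple _ 5 1 2 3) //= perm21 -E3.
case/negP: nA; apply: (@contains_three _ _ 6 _ _ _ x [:: x; y; z; a; b; c]).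
- by rewrite /= !inE !negb_or xy xz yz ab bc ac !(eq_sym _ a) ax ay az
    !(eq_sym _ b) bx bY bz !(eq_sym _ c) cx cy cz.
- by [].
- by rewrite (@imset_triple _ 6 0 1 3) //= -E1.
- by rewrite (@imset_triple _ 6 0 2 4) //= -E2.
- by rewrite (@imset_triple _ 6 1 2 5) //= -E3.
Qed.

(** In each of the configurations the labels 1, 2, 3 are pairwise joined by
    triples that omit the third label. *)
Lemma avoids_of_berge_free (V : finType) (F : {set {set V}}) :
  berge_free F -> avoids F [:: confA; confB; confC].
Proof.
move=> bf.
have no m (e1 e2 e3 : {set 'I_m}) (i1 i2 i3 : 'I_m) :
    [/\ i1 \in e1, i2 \in e1 & i3 \notin e1] ->
    [/\ i1 \in e2, i3 \in e2 & i2 \notin e2] ->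
    [/\ i2 \in e3, i3 \in e3 & i1 \notin e3] ->
    ~~ contains F (Config [set e1; e2; e3]).
  move=> h1 h2 h3; apply/negP=> /containsP3[f [injf [F1 F2 F3]]].
  by apply: (bf (f i1) (f i2) (f i3) _ _ _ F1 F2 F3); rewrite !mem_imset.
have lab m (h : 2 < m.+1) : (inord 0 : 'I_m.+1) = 0 :> nat /\
    (inord 1 : 'I_m.+1) = 1 :> nat /\ (inord 2 : 'I_m.+1) = 2 :> nat.
  by rewrite !inordK //; lia.
rewrite /avoids /=; apply/and4P; split=> //.
- have [E0 [E1 E2]] := lab 5 isT.
  by apply: (no 6 _ _ _ (inord 0) (inord 1) (inord 2));
    rewrite !inE ?E0 ?E1 ?E2.
- have [E0 [E1 E2]] := lab 4 isT.
  by apply: (no 5 _ _ _ (inord 0) (inord 1) (inord 2));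
    rewrite !inE ?E0 ?E1 ?E2.
- have [E0 [E1 E2]] := lab 3 isT.
  by apply: (no 4 _ _ _ (inord 0) (inord 1) (inord 2));
    rewrite !inE ?E0 ?E1 ?E2.
Qed.

(** * Mantel's theorem with its extremal graphs *)

Lemma mul_sub_le_quarter (N D : nat) : D * (N - D) <= N ^ 2 %/ 4.
Proof.
case: (leqP D N) => h; last by rewrite (_ : N - D = 0) ?muln0 //; lia.
have := nat_AGM2 D (N - D); rewrite subnKC // => agm.
by rewrite leq_divRL // mulnC; apply: leq_trans agm _.
Qed.

Lemma mul_sub_eq_quarter (N D : nat) :
  D <= N -> D * (N - D) = N ^ 2 %/ 4 -> D = N./2 \/ N - D = N./2.
Proof.
move=> h E; have : N ^ 2 < (D * (N - D)).+1 * 4 by rewrite -ltn_divLR // -E.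
rewrite -mulnn => lt.
have : D <= (N - D).+1 by rewrite leqNgt; apply/negP => far; nia.
have : N - D <= D.+1 by rewrite leqNgt; apply/negP => far; nia.
lia.
Qed.

(** The neighbourhood I of a vertex of maximum degree D is independent, so every
    edge has an end in the complement of I.  Counting edges from those ends,
    once for each end and once more for each edge into I, bounds the degree sum
    by 2 D (|W| - D).  Equality forces every vertex outside I to have I as its
    neighbourhood. *)
Lemma mantel (V : finType) (e : rel V) (W : {set V}) :
  symmetric e -> (forall u v, e u v -> u \in W) ->
  (forall u v w, e u v -> e v w -> e u w -> False) ->
  \sum_(v : V) #|[set u | e v u]| <= (#|W| ^ 2 %/ 4).*2 /\
  (\sum_(v : V) #|[set u | e v u]| = (#|W| ^ 2 %/ 4).*2 ->
   exists A : {set V}, [/\ A \subset W, #|A| = #|W|./2 &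
     {in W &, forall u v, e u v = ((u \in A) != (v \in A))}]).
Proof.
move=> sym eW notri; set N := fun v => [set u | e v u].
have eW2 u v : e u v -> v \in W by rewrite sym; apply: eW.
have [W0|[v0 v0W]] := set_0Vmem W.
  rewrite big1 => [|v _]; last first.
    by apply: eq_card0 => u; rewrite inE; apply/negP=> /eW; rewrite W0 inE.
  split=> // _; exists set0; rewrite W0 sub0set cards0; split=> // u v.
  by rewrite inE.
pose v := [arg max_(v > v0 in W) #|N v|].
have [vW vmax] : v \in W /\ {in W, forall y, #|N y| <= #|N v|}.
  by rewrite /v; case: arg_maxnP.
set I := N v; set D := #|I|.
have IW : I \subset W by apply/subsetP=> u; rewrite inE => /eW2.
have indI : {in I &, forall y z, e y z = false}.
  move=> y z; rewrite !inE => vy vz; apply/negP=> yz.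
  exact: notri vy yz vz.
have cardN B y : #|N y :&: B| = \sum_(z in B) e y z.
  rewrite -sum1_card big_mkcond [RHS]big_mkcond; apply: eq_bigr => z _.
  by rewrite !inE; case: (e y z); case: (z \in B).
have NI y : y \in I -> N y = N y :&: (W :\: I).
  move=> yI; apply/setP=> z; rewrite !inE; case: (boolP (e y z)) => //= yz.
  rewrite (eW2 _ _ yz) andbT; apply/esym/negP => vz.
  by have := indI _ _ yI (_ : z \in I); rewrite yz inE => /(_ vz).
have sumE : \sum_(y : V) #|N y| = \sum_(y in W :\: I) (#|N y| + #|N y :&: I|).
  rewrite big_split /= (bigID (mem W)) /= [X in _ + X]big1 => [|y yW].
    rewrite addn0 (bigID (mem I)) /= addnC; congr (_ + _).
      by apply: eq_bigl => y; rewrite in_setD andbC.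
    transitivity (\sum_(y in I) \sum_(z in W :\: I) e y z).
      apply: eq_big => [y|y /andP[_ yI]]; last by rewrite NI // cardN.
      by rewrite andb_idl // => /(subsetP IW).
    rewrite exchange_big; apply: eq_bigr => z _; rewrite cardN.
    by apply: eq_bigr => y _; rewrite sym.
  by apply: eq_card0 => z; rewrite inE; apply/negP => /eW; rewrite (negPf yW).
have cWI : #|W :\: I| = #|W| - D by rewrite cardsD (setIidPr IW).
have DW : D <= #|W| by apply: subset_leq_card.
have dI y : #|N y :&: I| <= D by apply/subset_leq_card/subsetIr.
have le y : y \in W :\: I -> #|N y| + #|N y :&: I| <= D.*2
    ?= iff (#|N y| + #|N y :&: I| == D.*2).
  rewrite inE => /andP[_ yW]; apply: leqif_eq; rewrite -addnn leq_add //.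
  exact: vmax.
have := leqif_sum le; rewrite -sumE sum_nat_const cWI => -[leS eqS].
have leQ := mul_sub_le_quarter #|W| D.
split; first by apply: leq_trans leS _; rewrite -doubleMr leq_double mulnC.
move=> Ssum; have /eqP Smax : \sum_y #|N y| == (#|W| - D) * D.*2.
  by rewrite eqn_leq leS Ssum /= -doubleMr leq_double mulnC.
have DQ : D * (#|W| - D) = #|W| ^ 2 %/ 4.
  by move: Smax; rewrite Ssum -doubleMr mulnC => /double_inj.
move: eqS; rewrite Smax eqxx => /esym/forall_inP full.
have NW y : y \in W :\: I -> N y = I.
  move=> yWI; have /eqP := full y yWI; have := dI y => dy.
  have : #|N y| <= D by move: yWI; rewrite inE => /andP[_ /vmax].
  move=> dNy Esum; have : I \subset N y.
    have /eqP <- : N y :&: I == I by rewrite eqEcard subsetIr -/D; lia.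
    exact: subsetIl.
  move=> sub; apply/esym/eqP; rewrite eqEcard sub -/D; lia.
have eI : {in W &, forall u w, e u w = ((u \in I) != (w \in I))}.
  move=> u w uW wW; have [uI|uI] := boolP (u \in I).
    have [wI|wI] := boolP (w \in I); first by rewrite indI.
    have : u \in N w by rewrite NW // !inE wW andbT; rewrite inE in wI.
    by rewrite inE sym.
  have : (w \in N u) = (w \in I).
    by rewrite NW // !inE uW andbT; rewrite inE in uI.
  by rewrite inE => ->; case: (w \in I).
case: (mul_sub_eq_quarter DW DQ) => half; first by exists I.
exists (W :\: I); split; rewrite ?subsetDl ?cWI // => u w uW wW.
by rewrite eI // !in_setD uW wW !andbT; case: (u \in I); case: (w \in I).
Qed.

Lemma quarter_square (N : nat) : N ^ 2 %/ 4 = N./2 * uphalf N.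
Proof.
have [k [->|->]] : exists k, N = k.*2 \/ N = k.*2.+1.
- by exists N./2; lia.
- by rewrite (_ : k.*2 ^ 2 = k * k * 4) ?mulnK ?uphalf_double ?doubleK //
    -mulnn; lia.
- rewrite (_ : k.*2.+1 ^ 2 = k * k.+1 * 4 + 1) -?mulnn; last by lia.
  by rewrite divnMDl //= uphalf_double doubleK addn0.
Qed.

(** * The graph of the bases *)

(** The map s selects in every triple T of F a vertex, its apex, such that the
    opposite pair, the base of T, lies in no other triple of F. *)
Definition apex_choice (V : finType) (F : {set {set V}})
    (s : {set V} -> V) : Prop :=
  {in F, forall T, s T \in T} /\
  {in F &, forall T T' : {set V}, T :\ s T \subset T' -> T = T'}.

Definition base_graph (V : finType) (F : {set {set V}})
    (s : {set V} -> V) : rel V :=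
  fun u v => (u != v) && [exists T in F, [set u; v] \subset T :\ s T].

Definition base_nbhd (V : finType) (F : {set {set V}})
    (s : {set V} -> V) (v : V) : {set V} :=
  [set u | base_graph F s v u].

Lemma card_base (V : finType) (F : {set {set V}}) (s : {set V} -> V)
    (T : {set V}) :
  triple_system F -> apex_choice F s -> T \in F -> #|T :\ s T| = 2.
Proof.
move=> /forall_inP F3 [sT _] FT.
by have := cardsD1 (s T) T; rewrite sT // (eqP (F3 _ FT)) => -[].
Qed.

Lemma base_graphP (V : finType) (F : {set {set V}}) (s : {set V} -> V)
    (u v : V) :
  triple_system F -> apex_choice F s -> base_graph F s u v ->
  u != v /\ exists2 T, T \in F & T :\ s T = [set u; v].
Proof.
move=> F3 sP /andP[uv /exists_inP[T FT sub]]; split=> //; exists T => //.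
by apply/esym/eqP; rewrite eqEcard sub (card_base F3 sP FT) cards2 uv.
Qed.

Lemma base_graph_sym (V : finType) (F : {set {set V}}) (s : {set V} -> V) :
  symmetric (base_graph F s).
Proof. by move=> u v; rewrite /base_graph eq_sym setUC. Qed.

Lemma base_graph_in_triple (V : finType) (F : {set {set V}})
    (s : {set V} -> V) (T : {set V}) (u v : V) :
  triple_system F -> apex_choice F s -> T \in F -> u \in T -> v \in T ->
  base_graph F s u v -> T :\ s T = [set u; v].
Proof.
move=> F3 sP FT uT vT /(base_graphP F3 sP)[_ [T1 F1 E1]].
suff <- : T1 = T by [].
by apply: (proj2 sP) => //; rewrite E1 subUset !sub1set uT.
Qed.

Lemma apex_not_adjacent (V : finType) (F : {set {set V}})
    (s : {set V} -> V) (T : {set V}) (y : V) :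
  triple_system F -> apex_choice F s -> T \in F -> y \in T ->
  base_graph F s y (s T) = false.
Proof.
move=> F3 sP FT yT; apply/negP=> ys.
have := base_graph_in_triple F3 sP FT yT (proj1 sP _ FT) ys.
by move/setP/(_ (s T)); rewrite !inE !eqxx orbT.
Qed.

(** If yt and zt are the bases of T1 and T2, then T1, T2 and T cover the pairs
    of y, z, t cyclically; a coincidence among the triples would make the two
    distinct pairs yt and zt bases of the same triple. *)
Lemma base_nbhd_disjoint (V : finType) (F : {set {set V}})
    (s : {set V} -> V) (T : {set V}) (y z t : V) :
  triple_system F -> berge_free F -> apex_choice F s -> T \in F ->
  y \in T -> z \in T -> y != z ->
  base_graph F s y t -> base_graph F s z t -> False.
Proof.
move=> F3 bf sP FT yT zT yz yt zt.
have [Nyt [T1 F1 E1]] := base_graphP F3 sP yt.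
have [Nzt [T2 F2 E2]] := base_graphP F3 sP zt.
have sub1 a : a \in [set y; t] -> a \in T1 by rewrite -E1; apply/subsetP/subsetDl.
have sub2 a : a \in [set z; t] -> a \in T2 by rewrite -E2; apply/subsetP/subsetDl.
have diff : [set y; t] <> [set z; t].
  by move/setP/(_ y); rewrite !inE eqxx (negPf yz) (negPf Nyt).
have yT1 : y \in T1 by apply: sub1; rewrite !inE eqxx.
have zT2 : z \in T2 by apply: sub2; rewrite !inE eqxx.
have tT1 : t \in T1 by apply: sub1; rewrite !inE eqxx orbT.
have tT2 : t \in T2 by apply: sub2; rewrite !inE eqxx orbT.
have [tT|tT] := boolP (t \in T).
  apply: diff; rewrite -(base_graph_in_triple F3 sP FT yT tT yt).
  exact: base_graph_in_triple zt.
apply: (bf y z t T T1 T2 FT F1 F2); split=> //.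
- apply/negP=> zT1; apply: diff.
  by rewrite -E1; apply: base_graph_in_triple zt.
- apply/negP=> yT2; apply: diff.
  by rewrite -E2; apply/esym; apply: base_graph_in_triple yt.
Qed.

Lemma base_graph_triangle_free (V : finType) (F : {set {set V}})
    (s : {set V} -> V) (u v w : V) :
  triple_system F -> berge_free F -> apex_choice F s ->
  base_graph F s u v -> base_graph F s v w -> base_graph F s u w -> False.
Proof.
move=> F3 bf sP /(base_graphP F3 sP)[uv [T FT ET]] vw uw.
have sub a : a \in [set u; v] -> a \in T by rewrite -ET; apply/subsetP/subsetDl.
by apply: (base_nbhd_disjoint F3 bf sP FT _ _ uv uw vw);
  apply: sub; rewrite !inE eqxx ?orbT.
Qed.

(** The neighbourhoods of the vertices of T are disjoint subsets of the
    complement of the apex of T. *)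
Lemma sum_degree_triple (V : finType) (F : {set {set V}})
    (s : {set V} -> V) (T : {set V}) :
  triple_system F -> berge_free F -> apex_choice F s -> T \in F ->
  \sum_(y in T) #|base_nbhd F s y| <= #|V| - 1.
Proof.
move=> F3 bf sP FT.
have -> : \sum_(y in T) #|base_nbhd F s y| =
    \sum_(t : V) \sum_(y in T) base_graph F s y t.
  rewrite exchange_big; apply: eq_bigr => y _.
  rewrite -sum1_card big_mkcond; apply: eq_bigr => t _.
  by rewrite inE; case: base_graph.
rewrite (bigD1 (s T)) //= big1 ?add0n => [|y yT]; last first.
  by rewrite apex_not_adjacent.
have -> : #|V| - 1 = \sum_(t | t != s T) 1.
  by rewrite sum1_card subn1 -(cardC1 (s T)); apply: eq_card.
apply: leq_sum => t _.
have [/exists_inP[y yT yt]|/exists_inPn none] :=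
    boolP [exists y in T, base_graph F s y t].
  rewrite (bigD1 y) //= yt big1 // => z /andP[zT zy].
  case: (boolP (base_graph F s z t)) => // zt.
  by case: (base_nbhd_disjoint F3 bf sP FT zT yT zy zt yt).
by rewrite big1 // => y yT; rewrite (negPf (none y yT)).
Qed.

(** A triple whose base contains v is determined by the other end of its
    base. *)
Lemma card_base_nbhd (V : finType) (F : {set {set V}})
    (s : {set V} -> V) (v : V) :
  triple_system F -> apex_choice F s ->
  #|base_nbhd F s v| = #|[set T in F | v \in T :\ s T]|.
Proof.
move=> F3 sP; set D := [set T in F | v \in T :\ s T].
pose other (T : {set V}) := odflt v [pick u in T :\ s T :\ v].
have otherP T : T \in D ->
    v != other T /\ T :\ s T = [set v; other T].
  rewrite inE => /andP[FT vT].
  have /cards1P[a Ea] : #|T :\ s T :\ v| == 1.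
    by have := cardsD1 v (T :\ s T); rewrite vT (card_base F3 sP FT); lia.
  have -> : other T = a.
    rewrite /other Ea; case: pickP => [b|/(_ a)]; rewrite !inE ?eqxx //.
    by move/eqP.
  have : a \in T :\ s T :\ v by rewrite Ea set11.
  by rewrite 2!inE eq_sym => /andP[-> _]; rewrite -Ea setD1K.
have FD T : T \in D -> T \in F by rewrite inE => /andP[].
have -> : base_nbhd F s v = other @: D.
  apply/setP=> u; apply/idP/imsetP=> [|[T DT ->]]; rewrite inE.
    move=> /(base_graphP F3 sP)[vu [T FT ET]].
    have DT : T \in D by rewrite inE FT ET !inE eqxx.
    exists T => //; have [vo] := otherP T DT; rewrite ET => /setP/(_ u).
    by rewrite !inE eqxx orbT eq_sym (negPf vu) /= => /esym/eqP.
  have [vo ET] := otherP T DT; apply/andP; split=> //.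
  by apply/exists_inP; exists T; rewrite ?FD // ET.
apply: card_in_imset => T T' DT DT' E.
apply: (proj2 sP); rewrite ?FD //.
have [_ ->] := otherP T DT; rewrite E.
by have [_ <-] := otherP T' DT'; rewrite subsetDl.
Qed.

Lemma sum_over_bases (V : finType) (F : {set {set V}})
    (s : {set V} -> V) (f : V -> nat) :
  triple_system F -> apex_choice F s ->
  \sum_(T in F) \sum_(v in T :\ s T) f v = \sum_v #|base_nbhd F s v| * f v.
Proof.
move=> F3 sP.
rewrite (exchange_big_dep predT) //=; apply: eq_bigr => v _.
by rewrite sum_nat_const card_base_nbhd // -cardsE; congr (#|pred_of_set _| * _);
  apply/setP=> T; rewrite !inE.
Qed.

Lemma handshake (V : finType) (F : {set {set V}}) (s : {set V} -> V) :
  triple_system F -> apex_choice F s ->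
  \sum_v #|base_nbhd F s v| = #|F|.*2.
Proof.
move=> F3 sP; under eq_bigr do rewrite -[#|_|]muln1.
rewrite -sum_over_bases //.
under eq_bigr => T FT do rewrite sum1_card (card_base F3 sP FT).
by rewrite sum_nat_const muln2.
Qed.

(** Summing the degree bound over all triples and comparing with
    Cauchy-Schwarz.  Every apex contributes at least 1 because no vertex is
    isolated, which improves the factor n - 1 to n - 2. *)
Lemma few_triples_of_no_isolated (V : finType) (F : {set {set V}})
    (s : {set V} -> V) :
  triple_system F -> berge_free F -> apex_choice F s -> 0 < #|V| ->
  (forall v, 0 < #|base_nbhd F s v|) ->
  4 * #|F| <= #|V| * (#|V| - 2) /\
  (4 * #|F| = #|V| * (#|V| - 2) -> #|V| = 4).
Proof.
move=> F3 bf sP V0 dpos; set n := #|V|; set m := #|F|.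
pose d v := #|base_nbhd F s v|.
have tri T : T \in F -> \sum_(y in T) d y <= n - 1.
  exact: sum_degree_triple.
have splitT T (f : V -> nat) : T \in F ->
    \sum_(y in T) f y = f (s T) + \sum_(y in T :\ s T) f y.
  move=> FT; rewrite (big_setD1 (s T)) //=; exact: (proj1 sP).
(* Cauchy-Schwarz is used as nonnegativity of the square of 2 d - (n - 2);
   (n - 2) / 2 is the degree that equality forces on every vertex. *)
have cs v : 4 * (d v * (n - 2)) <= 4 * (d v * d v) + (n - 2) ^ 2
     ?= iff ((d v).*2 == n - 2).
  have := nat_Cauchy (d v).*2 (n - 2).
  by congr (_ <= _ ?= iff _); rewrite -?mulnn; nia.
have hs : \sum_v d v = m.*2 by apply: handshake.
have sq : \sum_v d v * d v + m <= m * (n - 1).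
  rewrite -sum_over_bases // /m -sum1_card -big_split /= mulnC.
  rewrite big_distrr /=; apply: leq_sum => T FT; rewrite muln1.
  by rewrite addnC; apply: leq_trans (tri T FT); rewrite [X in _ <= X](splitT T) // leq_add2r dpos.
have [x _] : exists x : V, x \in V by apply/card_gt0P.
have [T0 FT0] : exists T, T \in F.
  have := dpos x; rewrite card_base_nbhd // => /card_gt0P[T].
  by rewrite inE => /andP[FT _]; exists T.
have m0 : 0 < m by apply/card_gt0P; exists T0.
have n3 : 3 <= n by move/forall_inP/(_ _ FT0)/eqP: F3 => <-; apply: max_card.
set S := \sum_v d v * d v in sq.
have L : \sum_v 4 * (d v * (n - 2)) = 4 * (m.*2 * (n - 2)).
  by rewrite -big_distrr /= -big_distrl /= hs.
have R : \sum_v (4 * (d v * d v) + (n - 2) ^ 2) = 4 * S + n * (n - 2) ^ 2.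
  by rewrite big_split /= -big_distrr /= sum_nat_const.
have := leqif_sum (P := xpredT) (fun v _ => cs v).
rewrite L R; case=> le eqc.
have Smc : S <= m * (n - 2) by move: sq; rewrite (_ : n - 1 = (n - 2).+1) ?mulnS; lia.
have n2 : 0 < n - 2 by lia.
split=> [|meq].
  rewrite -(leq_pmul2r n2); move: le Smc; rewrite -mulnn; nia.
have reg v : (d v).*2 = n - 2.
  suff /forall_inP/(_ v isT)/eqP : [forall (v | xpredT v), (d v).*2 == n - 2] by [].
  rewrite -eqc eqn_leq le -mulnn; move: Smc meq; nia.
(* Three degrees (n - 2) / 2 add up to at most n - 1 only if n <= 4, and n - 2
   is even and positive. *)
have : \sum_(y in T0) (d y).*2 = 3 * (n - 2).
  by under eq_bigr do rewrite reg; rewrite sum_nat_const (eqP (forall_inP F3 _ FT0)).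
under eq_bigr do rewrite -muln2.
rewrite -big_distrl /=; have := tri T0 FT0; have := reg x; lia.
Qed.

(** Mantel's theorem on the complement of x.  In the extremal case every vertex
    other than x is adjacent to an end of each base, which an apex never is. *)
Lemma triples_with_isolated (V : finType) (F : {set {set V}})
    (s : {set V} -> V) (x : V) :
  triple_system F -> berge_free F -> apex_choice F s ->
  base_nbhd F s x = set0 ->
  #|F| <= (#|V| - 1) ^ 2 %/ 4 /\
  (#|F| = (#|V| - 1) ^ 2 %/ 4 ->
   exists2 A : {set V}, x \notin A /\ #|A| = (#|V| - 1)./2 &
     F = [set [set x; u; v] | u in A, v in ~: (x |: A)]).
Proof.
move=> F3 bf sP x0.
have sym := base_graph_sym F s.
have nx u : base_graph F s x u = false.
  by move/setP/(_ u): x0; rewrite !inE.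
have inW u v : base_graph F s u v -> u \in [set~ x].
  by rewrite !inE; apply: contraTneq => ->; rewrite nx.
have tf u v w := @base_graph_triangle_free V F s u v w F3 bf sP.
have [] := mantel sym inW tf.
have -> : #|[set~ x]| = #|V| - 1 by rewrite cardsC1 subn1.
rewrite (handshake F3 sP) leq_double => le eqA; split=> // mE.
have [|A [AW cA AE]] := eqA; first by rewrite mE.
have xA : x \notin A by apply/negP=> /(subsetP AW); rewrite !inE eqxx.
exists A => //.
have tripleE T u v : T \in F -> u != v -> T :\ s T = [set u; v] ->
    base_graph F s u v /\ T = [set x; u; v].
  move=> FT uv ET; have sT := proj1 sP _ FT.
  have adj : base_graph F s u v.
    by rewrite /base_graph uv; apply/exists_inP; exists T; rewrite // ET.
  have sub a : a \in [set u; v] -> a \in T.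
    by rewrite -ET; apply/subsetP/subsetDl.
  have uT : u \in T by apply: sub; rewrite !inE eqxx.
  have vT : v \in T by apply: sub; rewrite !inE eqxx orbT.
  have uW := inW _ _ adj; have vW : v \in [set~ x] by apply: (inW v u); rewrite sym.
  split=> //; rewrite -setUA -ET.
  suff <- : s T = x by rewrite setD1K.
  have [//|sx] := eqVneq (s T) x; have sW : s T \in [set~ x] by rewrite !inE.
  have := AE _ _ uW vW; have := AE _ _ uW sW; have := AE _ _ vW sW.
  rewrite !apex_not_adjacent // adj.
  by case: (u \in A); case: (v \in A); case: (s T \in A).
have WE v : v != x -> v \in [set~ x] by rewrite !inE.
apply/setP=> T; apply/idP/imset2P=> [FT|[u v uA + ->]]; last first.
  rewrite 3!inE negb_or => /andP[vx vA].
  have uW := subsetP AW _ uA.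
  have uv : base_graph F s u v by rewrite (AE _ _ uW (WE _ vx)) uA.
  have [Nuv [T' FT' ET']] := base_graphP F3 sP uv.
  by have [_ <-] := tripleE _ _ _ FT' Nuv ET'.
have /eqP/cards2P[u [v [uv ET]]] := card_base F3 sP FT.
have [adj TE] := tripleE _ _ _ FT uv ET.
have uW := inW _ _ adj; have vW : v \in [set~ x] by apply: (inW v u); rewrite sym.
have := adj; rewrite AE //; move: uW vW; rewrite !in_setC1 => ux vx.
have [uA|uA] := boolP (u \in A) => /= vA.
  by exists u v; rewrite // !inE negb_or vx.
exists v u; rewrite // ?inE ?negb_or ?ux ?uA //; last by rewrite TE setUAC.
by case: (v \in A) vA.
Qed.

(** * Structure of large systems *)

(** If none of the three pairs of T were private to T, the other triples through
    these pairs would form a forbidden cyclic pattern. *)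
Lemma exists_apex_choice (V : finType) (F : {set {set V}}) (x0 : V) :
  triple_system F -> berge_free F -> exists s, apex_choice F s.
Proof.
move=> /forall_inP F3 bf.
have card3 T : T \in F -> #|T| = 3 by move=> /F3/eqP.
pose own (T : {set V}) x := [forall T' in F, (T :\ x \subset T') ==> (T' == T)].
have ownP T : T \in F -> exists2 x, x \in T & own T x.
  move=> FT; case: (boolP [exists x in T, own T x]) => [/exists_inP//|].
  move=> /exists_inPn none.
  have other x : x \in T -> exists T', [/\ T' \in F, T :\ x \subset T' & x \notin T'].
    move=> xT; have /forall_inPn[T' FT'] := none x xT.
    rewrite negb_imply => /andP[sub ne]; exists T'; split=> //.
    apply: contraNN ne => xT'; rewrite eq_sym eqEcard !card3 // andbT.
    by rewrite -(setD1K xT) subUset sub1set xT'.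
  have /card_gt2P[x [y [z [[xT yT zT] [xy yz zx]]]]] : 2 < #|T| by rewrite card3.
  have [Tx [Fx /subsetP Sx Nx]] := other x xT.
  have [Ty [Fy /subsetP Sy Ny]] := other y yT.
  have [Tz [Fz /subsetP Sz Nz]] := other z zT.
  case: (bf x y z Tz Ty Tx) => //; split=> //;
    [apply: Sz | apply: Sz | apply: Sy | apply: Sy | apply: Sx | apply: Sx];
    by rewrite !inE ?xT ?yT ?zT ?xy ?zx ?yz // eq_sym ?xy ?zx ?yz.
exists (fun T : {set V} => odflt x0 [pick x in T | own T x]).
have sP (T : {set V}) : T \in F -> let x := odflt x0 [pick x in T | own T x] in
    (x \in T) && own T x.
  move=> FT /=; case: pickP => [//|no]; have [x xT ox] := ownP T FT.
  by have := no x; rewrite /= xT ox.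
split=> [T FT|T T' FT FT' sub]; first by have /andP[] := sP T FT.
have /andP[_ /forall_inP/(_ T' FT')] := sP T FT.
by rewrite sub => /eqP.
Qed.

(** When all triples share x, the pair opposite to x is private, since together
    with x it determines the triple. *)
Lemma apex_choice_common (V : finType) (F : {set {set V}}) (x : V) :
  triple_system F -> {in F, forall T : {set V}, x \in T} -> apex_choice F (fun=> x).
Proof.
move=> /forall_inP F3 xF; split=> // T T' FT FT' sub; apply/eqP.
rewrite eqEcard (eqP (F3 _ FT)) (eqP (F3 _ FT')) andbT.
by rewrite -(setD1K (xF _ FT)) subUset sub1set xF.
Qed.

Lemma base_nbhd_common (V : finType) (F : {set {set V}}) (x : V) :
  base_nbhd F (fun=> x) x = set0.
Proof.
apply/setP=> u; rewrite !inE; apply/negP=> /andP[_ /exists_inP[T _ /subsetP]].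
by move/(_ x); rewrite !inE !eqxx => /(_ isT).
Qed.

Lemma two_triples_meet (V : finType) (F : {set {set V}}) :
  triple_system F -> #|V| = 4 -> #|F| = 2 ->
  exists x, {in F, forall T : {set V}, x \in T}.
Proof.
move=> /forall_inP F3 V4 /eqP/cards2P[T1 [T2 [_ EF]]].
have T13 : #|T1| = 3 by apply/eqP/F3; rewrite EF !inE eqxx.
have T23 : #|T2| = 3 by apply/eqP/F3; rewrite EF !inE eqxx orbT.
have /card_gt0P[x] : 0 < #|T1 :&: T2|.
  by have := cardsUI T1 T2; have := max_card (T1 :|: T2); rewrite V4 T13 T23; lia.
rewrite inE => /andP[x1 x2]; exists x => T; rewrite EF !inE.
by case/orP=> /eqP->.
Qed.

(** The case without isolated vertices reaches the bound only for two triples on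
    four vertices, where moving both apices to a common vertex creates an
    isolated one. *)
Lemma berge_free_structure (V : finType) (F : {set {set V}}) :
  triple_system F -> berge_free F -> 0 < #|V| ->
  #|F| <= (#|V| - 1) ^ 2 %/ 4 /\
  (#|F| = (#|V| - 1) ^ 2 %/ 4 ->
   exists x, exists2 A : {set V}, x \notin A /\ #|A| = (#|V| - 1)./2 &
     F = [set [set x; u; v] | u in A, v in ~: (x |: A)]).
Proof.
move=> F3 bf V0; have /card_gt0P[x0 _] := V0.
have [s sP] := exists_apex_choice x0 F3 bf.
have [/existsP[x /eqP x_iso]|/existsPn none] :=
    boolP [exists x, base_nbhd F s x == set0].
  have [le eqF] := triples_with_isolated F3 bf sP x_iso.
  by split=> // /eqF[A]; exists x, A.
have [|le eq4] := few_triples_of_no_isolated F3 bf sP V0.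
  by move=> v; rewrite card_gt0.
have Q : #|V| * (#|V| - 2) <= 4 * ((#|V| - 1) ^ 2 %/ 4).
  rewrite quarter_square; move: #|V| => n.
  have [k [->|->]] : exists k, n = k.*2 \/ n = k.*2.+1.
  - by exists n./2; lia.
  - have -> : (k.*2 - 1)./2 = k.-1 by lia.
    have -> : uphalf (k.*2 - 1) = k by lia.
    nia.
  - have -> : (k.*2.+1 - 1)./2 = k by lia.
    have -> : uphalf (k.*2.+1 - 1) = k by lia.
    nia.
split=> [|mE]; first by rewrite -(leq_pmul2l (isT : 0 < 4)) (leq_trans le).
have V4 : #|V| = 4 by apply: eq4; apply/eqP; rewrite eqn_leq le mE.
have [|x xF] := two_triples_meet F3 V4; first by rewrite mE V4.
have [_] := triples_with_isolated F3 bf (apex_choice_common F3 xF)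
  (base_nbhd_common F x).
by move=> /(_ mE)[A]; exists x, A.
Qed.

(** * The extremal system *)

Lemma card_Fstar_vertex (n : nat) : 0 < n -> #|Fstar_vertex n| = n.
Proof.
by move=> n0; rewrite card_option card_sum !card_ord; lia.
Qed.

Lemma Fstar_triple_system (n : nat) : triple_system (Fstar n).
Proof.
apply/forall_inP=> _ /imset2P[i j _ _ ->].
by rewrite -setUA cardsU1 cards2 !inE.
Qed.

Lemma card_Fstar (n : nat) : #|Fstar n| = (n - 1) ^ 2 %/ 4.
Proof.
pose edge (p : 'I_(n.-1./2) * 'I_(uphalf n.-1)) : {set Fstar_vertex n} :=
  [set None; Some (inl p.1); Some (inr p.2)].
have -> : Fstar n = edge @: predT.
  apply/setP=> e; apply/imset2P/imsetP=> [[i j _ _ ->]|[[i j] _ ->]].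
    by exists (i, j).
  by exists i j.
rewrite card_imset; first by rewrite card_prod !card_ord quarter_square subn1.
move=> [i j] [i' j'] /= /setP E.
have := E (Some (inl i)); have := E (Some (inr j)).
rewrite !inE !eqxx /= => /esym/eqP[->] /esym.
by rewrite orbF => /eqP[->].
Qed.

(** Every triple contains the centre, so none of x, y, z is the centre; then any
    two of them would lie on opposite sides of the bipartition. *)
Lemma Fstar_berge_free (n : nat) : berge_free (Fstar n).
Proof.
pose side (v : Fstar_vertex n) := if v is Some (inl _) then true else false.
have cross e u v : e \in Fstar n -> u \in e -> v \in e ->
    u != v -> u != None -> v != None -> side u != side v.
  case/imset2P=> i j _ _ ->; rewrite !inE.
  by move=> /orP[/orP[]|] /eqP-> /orP[/orP[]|] /eqP->; rewrite ?eqxx.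
have centre e v : e \in Fstar n -> v \notin e -> v != None.
  by case/imset2P=> i j _ _ ->; apply: contraNneq => ->; rewrite !inE.
move=> x y z T1 T2 T3 F1 F2 F3 [x1 y1 z1] [x2 z2 y2] [y3 z3 x3].
have xy : x != y by apply: contraNneq x3 => ->.
have xz : x != z by apply: contraNneq x3 => ->.
have yz : y != z by apply: contraNneq y2 => ->.
have x0 := centre _ _ F3 x3; have y0 := centre _ _ F2 y2.
have z0 := centre _ _ F1 z1.
have := cross _ _ _ F1 x1 y1 xy x0 y0; have := cross _ _ _ F2 x2 z2 xz x0 z0.
have := cross _ _ _ F3 y3 z3 yz y0 z0.
by case: (side x); case: (side y); case: (side z).
Qed.

Lemma isomorphic_of_image (V W : finType) (F : {set {set V}})
    (G : {set {set W}}) (g : W -> V) :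
  bijective g -> [set g @: (e : {set W}) | e in G] = F -> isomorphic F G.
Proof.
move=> [f gK fK] <-; exists f; split; first by exists g.
rewrite -imset_comp -[RHS]imset_id; apply: eq_imset => e /=.
by rewrite -imset_comp -[RHS]imset_id; apply: eq_imset.
Qed.

Lemma card_isomorphic (V W : finType) (F : {set {set V}})
    (G : {set {set W}}) : isomorphic F G -> #|F| = #|G|.
Proof.
by move=> [f [bf <-]]; rewrite card_imset //; apply/imset_inj/bij_inj.
Qed.

Lemma double_star_isomorphic (V : finType) (n : nat) (x : V) (A : {set V}) :
  0 < n -> #|V| = n -> x \notin A -> #|A| = (n - 1)./2 ->
  isomorphic [set [set x; u; v] | u in A, v in ~: (x |: A)] (Fstar n).
Proof.
move=> n0 Vn xA cA; set B := ~: (x |: A).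
have cB : #|B| = uphalf n.-1.
  have := cardsC (x |: A); rewrite -/B cardsU1 xA cA Vn; lia.
rewrite subn1 in cA.
pose g (w : Fstar_vertex n) : V :=
  match w with
  | None => x
  | Some (inl i) => enum_val (cast_ord (esym cA) i)
  | Some (inr j) => enum_val (cast_ord (esym cB) j)
  end.
have gl i : g (Some (inl i)) \in A by apply: enum_valP.
have gr j : g (Some (inr j)) \in B by apply: enum_valP.
have BE v : v \in B -> (v != x) && (v \notin A) by rewrite !inE negb_or.
have ginj : injective g.
  move=> [[i|j]|] [[i'|j']|] E //.
  - by move/enum_val_inj/cast_ord_inj: E => ->.
  - by have := BE _ (gr j'); rewrite -E gl andbF.
  - by have := gl i; rewrite E (negPf xA).
  - by have := BE _ (gr j); rewrite E gl andbF.
  - by move/enum_val_inj/cast_ord_inj: E => ->.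
  - by have := BE _ (gr j); rewrite E eqxx.
  - by have := gl i'; rewrite -E (negPf xA).
  - by have := BE _ (gr j'); rewrite -E eqxx.
apply: (@isomorphic_of_image _ _ _ _ g).
  by apply: inj_card_bij => //; rewrite card_Fstar_vertex ?Vn.
have gE i j : g @: [set None; Some (inl i); Some (inr j)] =
    [set x; g (Some (inl i)); g (Some (inr j))].
  by rewrite !imsetU !imset_set1.
apply/setP=> T; apply/imsetP/imset2P=> [[_ /imset2P[i j _ _ ->] ->]|].
  by exists (g (Some (inl i))) (g (Some (inr j))); rewrite ?gE.
case=> u v uA vB ->.
pose i := cast_ord cA (enum_rank_in uA u).
pose j := cast_ord cB (enum_rank_in vB v).
exists [set None; Some (inl i); Some (inr j)]; first by apply: imset2_f.
by rewrite gE /g !cast_ordK !enum_rankK_in.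
Qed.

Lemma bijection_of_card (V W : finType) :
  #|V| = #|W| -> exists f : V -> W, bijective f.
Proof.
move=> E; exists (fun v => enum_val (cast_ord E (enum_rank v))).
by apply: inj_card_bij; rewrite ?E // => u v /enum_val_inj/cast_ord_inj/enum_rank_inj.
Qed.

Lemma triple_system_image (V W : finType) (f : V -> W) (F : {set {set V}}) :
  injective f -> triple_system F ->
  triple_system [set f @: (e : {set V}) | e in F].
Proof.
move=> injf /forall_inP F3; apply/forall_inP=> _ /imsetP[e Fe ->].
by rewrite card_imset // F3.
Qed.

Lemma berge_free_image (V W : finType) (f : V -> W) (F : {set {set V}}) :
  injective f -> berge_free F -> berge_free [set f @: (e : {set V}) | e in F].
Proof.
move=> injf bf x y z _ _ _ /imsetP[T1 F1 ->] /imsetP[T2 F2 ->] /imsetP[T3 F3 ->].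
move=> [/imsetP[a a1 ->] /imsetP[b b1 ->] nz] [a2 /imsetP[c c2 Ec] nb].
move: nz a2 nb; rewrite {}Ec !mem_imset // => nc a2 nb [b3 c3 na].
exact: (bf a b c T1 T2 T3).
Qed.

(** * The Turan number and its extremal systems *)

Theorem theorem11 (n : nat) (n_gt0 : 0 < n) :
  ex n [:: confA; confB; confC] = (n - 1) ^ 2 %/ 4 /\
  (forall (V : finType) (F : {set {set V}}),
     #|V| = n -> triple_system F -> avoids F [:: confA; confB; confC] ->
     (#|F| = (n - 1) ^ 2 %/ 4 <-> isomorphic F (Fstar n))).
Proof.
have upper (V : finType) (F : {set {set V}}) :
    #|V| = n -> triple_system F -> avoids F [:: confA; confB; confC] ->
    #|F| <= (n - 1) ^ 2 %/ 4 /\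
    (#|F| = (n - 1) ^ 2 %/ 4 -> isomorphic F (Fstar n)).
  move=> Vn F3 av; have bf := berge_free_of_avoids F3 av.
  have [|le eqF] := berge_free_structure F3 bf; first by rewrite Vn.
  rewrite Vn in le eqF; split=> // /eqF[x [A [xA cA] ->]].
  exact: double_star_isomorphic.
split=> [|V F Vn F3 av]; last first.
  have [_ eqF] := upper V F Vn F3 av; split=> // /card_isomorphic ->.
  exact: card_Fstar.
apply/eqP; rewrite eqn_leq; apply/andP; split.
  apply/bigmax_leqP=> F /andP[F3 av].
  by have [] := upper _ F (card_ord n) F3 av.
have [f bijf] : exists f : Fstar_vertex n -> 'I_n, bijective f.
  by apply: bijection_of_card; rewrite card_Fstar_vertex ?card_ord.
have injf := bij_inj bijf.
rewrite -card_Fstar -(card_imset _ (imset_inj injf)).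
apply: (@leq_bigmax_cond _ _ (fun F : {set {set 'I_n}} => #|F|)).
rewrite triple_system_image ?Fstar_triple_system //=.
exact: avoids_of_berge_free (berge_free_image injf (@Fstar_berge_free n)).
Qed.
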